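(* Let $K$ be a field of characteristic $0$, let $D$ be a central division algebra over $K$ of degree $n$ (so $\dim_K D=n^2$), and let $L/K$ be a Galois splitting field for $D$ of degree $n$ with Galois group $\mathrm{Gal}(L/K)$. Fix a $\mathrm{Gal}(L/K)$-equivariant isomorphism of $L$-algebras $\Phi\colon L\otimes_K D\to M_n(L)$ and elements $d_1,d_2\in D$ generating $D$ as a $K$-algebra. Let $\Gamma$ be the quiver with a single vertex $v$ and two loops $e_1,e_2$ at $v$, with the trivial $K$-rational structure for $L/K$; write $\Gamma_K$ for the resulting $K$-rational quiver. Let $M$ be the representation of $\Gamma$ over $L$ given by $M(v)=L^n$ and $\phi_{e_i}=\Phi(1\otimes d_i)\in M_n(L)$, $i=1,2$, and let $M_K$ be the $K$-rational representation of $\Gamma_K$ obtained from $M$ by restriction of scalars from $L$ to $K$. Then the endomorphism ring of $M_K$ in the category of $K$-rational representations of $\Gamma_K$ is isomorphic to the opposite algebra of $D$: $$\mathrm{End}_{\Gamma_K}(M_K)\cong D^{\mathrm{op}}.$$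
   Context: A representation of the two-loop quiver $\Gamma$ over a field $F$ is an $F$-vector space with two $F$-linear endomorphisms $\phi_{e_1},\phi_{e_2}$, i.e. a module over the free algebra $F\langle e_1,e_2\rangle$. The trivial $K$-rational structure for $L/K$ means that $\mathrm{Gal}(L/K)$ acts trivially on the vertex and the edges of $\Gamma$. A $K$-rational representation of $\Gamma_K$ is an $L$-vector space with a semilinear $\mathrm{Gal}(L/K)$-action and two $L$-linear endomorphisms commuting with it; by Galois descent (taking Galois invariants) this is the same as a $K$-vector space with two $K$-linear endomorphisms. Under this identification, $M_K$ is $L^n$ regarded as a $K$-vector space $M_K(v)$, with $\phi_{e_1},\phi_{e_2}$ regarded as $K$-linear endomorphisms, and $\mathrm{End}_{\Gamma_K}(M_K)$ is the ring of $K$-linear endomorphisms of $L^n$ commuting with $\phi_{e_1}$ and $\phi_{e_2}$. *)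

(* Defs.v *)
From HB Require Import structures.
From mathcomp Require Import all_boot all_order all_fingroup all_algebra all_solvable all_field.

Set Implicit Arguments.
Unset Strict Implicit.
Unset Printing Implicit Defensive.

Import GRing.Theory.
Import VectorInternalTheory.

Local Open Scope ring_scope.

(* MathComp equips R^c with the reversed product, but not with scalars. *)
HB.instance Definition _ (K : comNzRingType) (A : algType K) :=
  GRing.LSemiModule.copy A^c A.
Fact converse_scalerAl (K : comNzRingType) (A : algType K)
  (k : K) (x y : A^c) : k *: (x * y) = (k *: x : A^c) * y.
Proof. exact: (scalerAr k (y : A) (x : A)). Qed.
HB.instance Definition _ (K : comNzRingType) (A : algType K) :=
  GRing.Lmodule_isLalgebra.Build K A^c (@converse_scalerAl K A).
Fact converse_scalerAr (K : comNzRingType) (A : algType K)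
  (k : K) (x y : A^c) : k *: (x * y) = x * (k *: y : A^c).
Proof. exact: (scalerAl k (y : A) (x : A)). Qed.
HB.instance Definition _ (K : comNzRingType) (A : algType K) :=
  GRing.Lalgebra_isAlgebra.Build K A^c (@converse_scalerAr K A).

(* The L-algebra L (x)_K D: coordinates over L in the canonical K-basis        *)
(* e_i := r2v (delta_mx 0 i) of D, multiplied with the structure constants of  *)
(* D. The lemmas below (tensM, tens_sum, tens_universal) characterise it.      *)
Definition tensor (K : fieldType) (L : fieldExtType K) (D : falgType K) :=
  'rV[L]_(dim D).

Section Tensor.
Variables (K : fieldType) (L : fieldExtType K) (D : falgType K).
Notation T := (tensor L D).

HB.instance Definition _ := GRing.Lmodule.copy T 'rV[L]_(dim D).

Definition tens (l : L) (d : D) : T := l *: map_mx (in_alg L) (v2r d).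

Definition tens_basis (i : 'I_(dim D)) : D := r2v (delta_mx 0 i).
Notation e := tens_basis.

Definition tensor_mul (x y : T) : T :=
  \sum_i \sum_j tens (x 0 i * y 0 j) (e i * e j).
Definition tensor_one : T := tens 1 1.

Lemma tensDl l l' d : tens (l + l') d = tens l d + tens l' d.
Proof. exact: scalerDl. Qed.
Lemma tensDr l d d' : tens l (d + d') = tens l d + tens l d'.
Proof. by rewrite /tens linearD map_mxD scalerDr. Qed.
Lemma tensZl (a l : L) d : tens (a * l) d = a *: tens l d.
Proof. by rewrite /tens scalerA. Qed.
Lemma tensZr (k : K) l d : tens l (k *: d) = tens (k *: l) d.
Proof.
rewrite /tens linearZ map_mxZ scalerA; congr (_ *: _).
by rewrite /= mulrC mulr_algl.
Qed.
Lemma tens0l d : tens 0 d = 0.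
Proof. exact: scale0r. Qed.
Lemma tens0r l : tens l 0 = 0.
Proof. by rewrite /tens linear0 map_mx0 scaler0. Qed.

Lemma tens_suml (I : finType) (F : I -> L) d :
  tens (\sum_i F i) d = \sum_i tens (F i) d.
Proof. exact: (big_morph (tens^~ d) (fun l l' => tensDl l l' d) (tens0l d)). Qed.
Lemma tens_sumr (I : finType) l (F : I -> D) :
  tens l (\sum_i F i) = \sum_i tens l (F i).
Proof. exact: (big_morph (tens l) (tensDr l) (tens0r l)). Qed.

Lemma tens_basis_sum d : d = \sum_i (v2r d) 0 i *: e i.
Proof.
rewrite -[LHS]v2rK [v2r d in LHS]row_sum_delta linear_sum.
by apply: eq_bigr => i _; rewrite linearZ.
Qed.

Lemma tens_coordE l d i : (tens l d : 'rV_(dim D)) 0 i = (v2r d) 0 i *: l.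
Proof. by rewrite !mxE mulrC /= mulr_algl. Qed.

Lemma tens_sum (x : T) : x = \sum_i tens (x 0 i) (e i).
Proof.
apply/rowP=> k; rewrite summxE (bigD1 k) //= tens_coordE r2vK mxE !eqxx scale1r.
rewrite big1 ?addr0 // => i ik.
by rewrite tens_coordE r2vK mxE eqxx /= eq_sym (negPf ik) scale0r.
Qed.

Lemma tensor_mulDl : left_distributive tensor_mul +%R.
Proof.
move=> x y z; rewrite -big_split; apply: eq_bigr => i _.
rewrite -big_split; apply: eq_bigr => j _.
by rewrite mxE mulrDl tensDl.
Qed.
Lemma tensor_mulDr : right_distributive tensor_mul +%R.
Proof.
move=> x y z; rewrite -big_split; apply: eq_bigr => i _.
rewrite -big_split; apply: eq_bigr => j _.
by rewrite mxE mulrDr tensDl.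
Qed.
Lemma tensor_mulZl a x y : a *: tensor_mul x y = tensor_mul (a *: x) y.
Proof.
rewrite scaler_sumr; apply: eq_bigr => i _.
rewrite scaler_sumr; apply: eq_bigr => j _.
by rewrite mxE -mulrA [RHS]tensZl.
Qed.
Lemma tensor_mulZr a x y : a *: tensor_mul x y = tensor_mul x (a *: y).
Proof.
rewrite scaler_sumr; apply: eq_bigr => i _.
rewrite scaler_sumr; apply: eq_bigr => j _.
by rewrite mxE mulrCA [RHS]tensZl.
Qed.
Lemma tensor_mul0l y : tensor_mul 0 y = 0.
Proof. by apply: (addIr (tensor_mul 0 y)); rewrite -tensor_mulDl !add0r. Qed.
Lemma tensor_mul0r x : tensor_mul x 0 = 0.
Proof. by apply: (addIr (tensor_mul x 0)); rewrite -tensor_mulDr !add0r. Qed.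
Lemma tensor_mul_suml (I : finType) (F : I -> T) y :
  tensor_mul (\sum_i F i) y = \sum_i tensor_mul (F i) y.
Proof.
exact: (big_morph (tensor_mul^~ y) (fun u v => tensor_mulDl u v y)
  (tensor_mul0l y)).
Qed.
Lemma tensor_mul_sumr (I : finType) (F : I -> T) x :
  tensor_mul x (\sum_i F i) = \sum_i tensor_mul x (F i).
Proof. exact: (big_morph (tensor_mul x) (tensor_mulDr x) (tensor_mul0r x)). Qed.

Lemma tensor_mul_tens l d l' d' :
  tensor_mul (tens l d) (tens l' d') = tens (l * l') (d * d').
Proof.
rewrite [d in RHS]tens_basis_sum mulr_suml tens_sumr; apply: eq_bigr => i _.
rewrite [d' in RHS]tens_basis_sum mulr_sumr tens_sumr; apply: eq_bigr => j _.
rewrite !tens_coordE -!scalerAl -!scalerAr !tensZr.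
by congr tens; rewrite !scalerA mulrC.
Qed.

Lemma tensor_mulA : associative tensor_mul.
Proof.
move=> x y z; rewrite [x]tens_sum !tensor_mul_suml; apply: eq_bigr => i _.
rewrite [y]tens_sum tensor_mul_suml !tensor_mul_sumr tensor_mul_suml.
apply: eq_bigr => j _.
rewrite [z]tens_sum !tensor_mul_sumr; apply: eq_bigr => k _.
by rewrite !tensor_mul_tens !mulrA.
Qed.
Lemma tensor_mul1l : left_id tensor_one tensor_mul.
Proof.
move=> x; rewrite [x]tens_sum tensor_mul_sumr; apply: eq_bigr => i _.
by rewrite tensor_mul_tens !mul1r.
Qed.
Lemma tensor_mul1r : right_id tensor_one tensor_mul.
Proof.
move=> x; rewrite [x]tens_sum tensor_mul_suml; apply: eq_bigr => i _.
by rewrite tensor_mul_tens !mulr1.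
Qed.
Lemma tensor_one_neq0 : tensor_one != 0 :> T.
Proof.
apply/eqP => /rowP H; case/eqP: (oner_neq0 D).
apply: (can_inj v2rK); apply/rowP=> i; move: (H i).
rewrite tens_coordE linear0 !mxE => /eqP.
by rewrite scaler_eq0 oner_eq0 orbF => /eqP.
Qed.

HB.instance Definition _ := GRing.Zmodule_isNzRing.Build T
  tensor_mulA tensor_mul1l tensor_mul1r tensor_mulDl tensor_mulDr
  tensor_one_neq0.
HB.instance Definition _ := GRing.Lmodule_isLalgebra.Build L T tensor_mulZl.
HB.instance Definition _ := GRing.Lalgebra_isAlgebra.Build L T tensor_mulZr.

Lemma tensM l d l' d' : tens l d * tens l' d' = tens (l * l') (d * d').
Proof. exact: tensor_mul_tens. Qed.
Lemma tens1 : tens 1 1 = 1.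
Proof. by []. Qed.

Lemma tens_universal (W : lmodType L) (f : D -> W) :
    {morph f : d d' / d + d'} ->
    (forall (k : K) d, f (k *: d) = (k%:A : L) *: f d) ->
  exists2 F : {linear T -> W}, (forall d, F (tens 1 d) = f d)
    & forall G : {linear T -> W}, (forall d, G (tens 1 d) = f d) -> G =1 F.
Proof.
move=> fD fZ; pose F (x : T) := \sum_i (x 0 i) *: f (e i).
have Flin : linear F.
  move=> a x y; rewrite scaler_sumr -big_split; apply: eq_bigr => i _.
  by rewrite !mxE scalerDl scalerA.
pose FL : {linear T -> W} :=
  HB.pack F (GRing.isLinear.Build L T W *:%R F Flin).
exists FL => [d | G GE x].
  have f0 : f 0 = 0 by apply: (addIr (f 0)); rewrite -fD !add0r.
  rewrite [d in RHS]tens_basis_sum (big_morph f fD f0).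
  by apply: eq_bigr => i _; rewrite fZ tens_coordE.
rewrite {1}[x]tens_sum linear_sum; apply: eq_bigr => i _.
by rewrite -[x 0 i]mulr1 tensZl linearZ /= GE mulr1.
Qed.

End Tensor.

Definition tensor_gal (K : fieldType) (L : splittingFieldType K)
    (D : falgType K) (s : gal_of {:L}) (x : tensor L D) : tensor L D :=
  map_mx s x.

Lemma tensor_gal_tens (K : fieldType) (L : splittingFieldType K)
    (D : falgType K) (s : gal_of {:L}) (l : L) (d : D) :
  tensor_gal s (tens l d) = tens (s l) d.
Proof.
apply/rowP=> i; rewrite [LHS]mxE !tens_coordE.
by rewrite linearZ.
Qed.

(* An action of Gal(L/K) on M_n(L) by semilinear ring automorphisms. For       *)
(* n > 1 an equivariant isomorphism from L (x)_K D, D a division algebra,      *)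
(* cannot be for the entrywise action, whose fixed ring is M_n(K): the action  *)
(* is the entrywise one twisted by a cocycle, and is left arbitrary here.      *)
(* MathComp composes automorphisms as (s * t) x = t (s x).                     *)
Record gal_alg_action (K : fieldType) (L : splittingFieldType K) (n : nat)
    (rho : gal_of {:L} -> 'M[L]_n -> 'M[L]_n) : Prop := GalAlgAction {
  gal_alg1 : forall A, rho 1%g A = A;
  gal_algJ : {in 'Gal({:L} / 1)%g &, forall s t A, rho (s * t)%g A = rho t (rho s A)};
  gal_algZ : {in 'Gal({:L} / 1)%g, forall s a A, rho s (a *: A) = s a *: rho s A};
  gal_algD : {in 'Gal({:L} / 1)%g, forall s, {morph rho s : A B / A + B}};
  gal_algM : {in 'Gal({:L} / 1)%g, forall s, {morph rho s : A B / A *m B}};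
  gal_alg_id : {in 'Gal({:L} / 1)%g, forall s, rho s 1%:M = 1%:M}
}.

(* V seen as a vector space over K, for an L-vector space V. *)
Definition res_space (K : fieldType) (L : fieldExtType K) (V : vectType L) : Type := V.

Section ResSpace.
Variables (K : fieldType) (L : fieldExtType K) (V : vectType L).
Notation R := (res_space V).

HB.instance Definition _ := GRing.Zmodule.copy R V.

Definition res_scale (k : K) (v : R) : R := (k%:A : L) *: (v : V).

Fact res_scalerA a b v : res_scale a (res_scale b v) = res_scale (a * b) v.
Proof. by rewrite /res_scale scalerA mulr_algl scalerA. Qed.
Fact res_scale1r : left_id 1 res_scale.
Proof. by move=> v; rewrite /res_scale scale1r scale1r. Qed.
Fact res_scalerDr : right_distributive res_scale +%R.
Proof. by move=> k u v; apply: scalerDr. Qed.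
Fact res_scalerDl v : {morph res_scale^~ v : a b / a + b}.
Proof. by move=> a b; rewrite /res_scale scalerDl scalerDl. Qed.
HB.instance Definition _ := GRing.Zmodule_isLmodule.Build K R
  res_scalerA res_scale1r res_scalerDr res_scalerDl.

Lemma res_scaleE (k : K) (v : R) : k *: v = (k%:A : L) *: (v : V).
Proof. by []. Qed.

Fact res_space_vect : Vector.axiom (dim V * dim L) R.
Proof.
pose f (v : R) : 'M[K]_(dim V, dim L) := \matrix_i v2r ((v2r (v : V)) 0 i).
exists (mxvec \o f) => [k u v /= | ].
  rewrite -linearP; congr (mxvec _); apply/matrixP=> i j.
  rewrite !mxE (_ : v2r _ = (k%:A : L) *: v2r (u : V) + v2r (v : V)).
    by rewrite !mxE mulr_algl linearP !mxE.
  exact: linearP.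
pose g (A : 'M[K]_(dim V, dim L)) : R := r2v (\row_i r2v (row i A)) : V.
exists (g \o vec_mx) => [v | A] /=.
  rewrite mxvecK /g -[RHS](v2rK (v : V)); congr (r2v _).
  by apply/rowP=> i; rewrite mxE rowK v2rK.
rewrite -[RHS]vec_mxK; congr (mxvec _); apply/row_matrixP=> i.
by rewrite rowK r2vK mxE r2vK.
Qed.
HB.instance Definition _ := Lmodule_hasFinDim.Build K R res_space_vect.

Definition res_end (f : 'End(V)) : 'End(R) := linfun (f : R -> R).

Lemma res_endE (f : 'End(V)) (v : R) : res_end f v = f v.
Proof.
have fl : linear (f : R -> R).
  by move=> k u w; rewrite linearD res_scaleE linearZ.
pose fL : {linear R -> R} :=
  HB.pack (f : R -> R) (GRing.isLinear.Build K R R *:%R (f : R -> R) fl).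
exact: (lfunE fL).
Qed.

End ResSpace.

Record rep (F : fieldType) := Rep {
  rep_space : vectType F;
  rep_e1 : 'End(rep_space);
  rep_e2 : 'End(rep_space)
}.

Section RepEnd.
Variables (F : fieldType) (M : rep F).

Definition is_rep_end (f : 'End(rep_space M)) : bool :=
  ((f \o rep_e1 M)%VF == (rep_e1 M \o f)%VF)
  && ((f \o rep_e2 M)%VF == (rep_e2 M \o f)%VF).

Record rep_end : Type := RepEnd {
  rep_end_val :> 'End(rep_space M);
  rep_endP : is_rep_end rep_end_val
}.
HB.instance Definition _ := [isSub for rep_end_val].
HB.instance Definition _ := [Choice of rep_end by <:].

Fact is_rep_end_submod : submod_closed (is_rep_end : {pred 'End(rep_space M)}).
Proof.
split=> [|k f g]; rewrite !unfold_in.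
  by rewrite !comp_lfun0l !comp_lfun0r !eqxx.
move=> /andP[/eqP f1 /eqP f2] /andP[/eqP g1 /eqP g2].
by rewrite !comp_lfunDl !comp_lfunDr -!comp_lfunZl -!comp_lfunZr
  f1 f2 g1 g2 !eqxx.
Qed.
HB.instance Definition _ :=
  GRing.isSubmodClosed.Build F 'End(rep_space M) is_rep_end is_rep_end_submod.
HB.instance Definition _ := [SubChoice_isSubZmodule of rep_end by <:].
HB.instance Definition _ := [SubZmodule_isSubLmodule of rep_end by <:].

Fact rep_end_oneP : is_rep_end \1%VF.
Proof. by rewrite /is_rep_end !comp_lfun1l !comp_lfun1r !eqxx. Qed.
Definition rep_end_one := RepEnd rep_end_oneP.

Fact rep_end_mulP (f g : rep_end) : is_rep_end (f \o g)%VF.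
Proof.
case: f g => [f /andP[/eqP f1 /eqP f2]] [g /andP[/eqP g1 /eqP g2]] /=.
by rewrite /is_rep_end -!comp_lfunA g1 g2 !comp_lfunA f1 f2 !eqxx.
Qed.
Definition rep_end_mul f g := RepEnd (rep_end_mulP f g).

Fact rep_end_mulA : associative rep_end_mul.
Proof. by move=> f g h; apply: val_inj; apply: comp_lfunA. Qed.
Fact rep_end_mul1l : left_id rep_end_one rep_end_mul.
Proof. by move=> f; apply: val_inj; apply: comp_lfun1l. Qed.
Fact rep_end_mul1r : right_id rep_end_one rep_end_mul.
Proof. by move=> f; apply: val_inj; apply: comp_lfun1r. Qed.
Fact rep_end_mulDl : left_distributive rep_end_mul +%R.
Proof. by move=> f g h; apply: val_inj; apply: comp_lfunDl. Qed.
Fact rep_end_mulDr : right_distributive rep_end_mul +%R.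
Proof. by move=> f g h; apply: val_inj; apply: comp_lfunDr. Qed.
(* Only a possibly zero ring: the zero representation is allowed. *)
HB.instance Definition _ := GRing.Zmodule_isPzRing.Build rep_end
  rep_end_mulA rep_end_mul1l rep_end_mul1r rep_end_mulDl rep_end_mulDr.

Lemma rep_end_mulE (f g : rep_end) v : (f * g) v = f (g v).
Proof. exact: comp_lfunE. Qed.
Lemma rep_end_scalerAl k (f g : rep_end) : k *: (f * g) = (k *: f) * g.
Proof. by apply: val_inj; apply: comp_lfunZl. Qed.
Lemma rep_end_scalerAr k (f g : rep_end) : k *: (f * g) = f * (k *: g).
Proof. by apply: val_inj; apply: comp_lfunZr. Qed.

End RepEnd.

(* On column vectors, so that a matrix algebra acts from the left. *)
Definition mx_rep (F : fieldType) (n : nat) (A1 A2 : 'M[F]_n) : rep F :=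
  @Rep F 'cV[F]_n (linfun (mulmx A1)) (linfun (mulmx A2)).

(* Restriction of scalars from L to K. By Galois descent, a K-rational         *)
(* representation for the trivial K-rational structure is a representation of  *)
(* the quiver over K.                                                          *)
Definition res_rep (K : fieldType) (L : fieldExtType K) (M : rep L) : rep K :=
  Rep (res_end (rep_e1 M)) (res_end (rep_e2 M)).

(* Main.v *)
(** The division algebra [D] acts on [L^n] through [Phi], and [L^n] has the
    same [K]-dimension [n ^ 2] as [D], so for a nonzero [v] the orbit map
    [x |-> x v] is bijective: [L^n] is a free left [D]-module of rank one.
    Since [d1] and [d2] generate [D], the endomorphisms of the representation
    are the [D]-linear ones, that is, the maps [x v |-> x d v]. *)

Require Import Defs.
From HB Require Import structures.
From mathcomp Require Import all_boot all_order all_fingroup all_algebra all_solvable all_field.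

Set Implicit Arguments.
Unset Strict Implicit.
Unset Printing Implicit Defensive.

Import GRing.Theory.
Local Open Scope ring_scope.

Section RankOneModule.
Variables (K : fieldType) (D : falgType K) (V : vectType K).
Variable act : {linear D -> 'End(V)}.
Hypotheses (act1 : act 1 = \1%VF)
  (actM : forall x y, act (x * y) = (act x \o act y)%VF).
Hypothesis divD : forall x : D, x != 0 -> x \is a GRing.unit.

(** The [x] whose action commutes with [g] form the kernel of the linear map [c]; this subspace
    contains 1 and [X] and is closed under products, so it is all of [D]. *)
Lemma commuting_generated (g : 'End(V)) (X : seq D) :
    <<1 & X>>%VS = {:D}%VS ->
    {in X, forall x, (g \o act x)%VF = (act x \o g)%VF} ->
  forall x, (g \o act x)%VF = (act x \o g)%VF.
Proof.
move=> genX gX.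
pose c (x : D) : 'End(V) := (g \o act x)%VF - (act x \o g)%VF.
have cl : linear c.
  move=> k x y; rewrite /c linearP comp_lfunDl comp_lfunDr.
  rewrite -comp_lfunZl -comp_lfunZr scalerBr opprD.
  by rewrite !addrA; congr (_ + _); rewrite addrAC.
pose cL : {linear D -> 'End(V)} :=
  HB.pack c (GRing.isLinear.Build K D 'End(V) *:%R c cl).
pose S := lker (linfun cL).
have memS x : (x \in S) = ((g \o act x)%VF == (act x \o g)%VF).
  by rewrite memv_ker lfunE /= subr_eq0.
have XS : (<<1 & X>> <= S)%VS.
  have S1 : (1 <= S)%VS.
    by rewrite -memvE memS act1 comp_lfun1l comp_lfun1r.
  (* A subspace containing 1 and stable under left multiplication by [1 + <<X>>] contains the
     generated algebra. *)
  apply: agenv_sub_modl => //; apply/prodvP=> x y xX.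
  have /subvP/(_ _ xX) : (1 + <<X>> <= S)%VS.
    rewrite subv_add S1; apply/span_subvP => z zX.
    by rewrite memS gX.
  rewrite !memS actM => /eqP xS /eqP yS.
  by rewrite comp_lfunA xS -!comp_lfunA yS.
by move=> x; apply/eqP; rewrite -memS (subvP XS) // genX memvf.
Qed.

Variable v : V.
Hypotheses (v_neq0 : v != 0) (dimV : \dim {:V} = \dim {:D}).

Definition orbit_fun (x : D) : V := act x v.
Fact orbit_fun_linear : linear orbit_fun.
Proof. by move=> k x y; rewrite /orbit_fun linearP add_lfunE scale_lfunE. Qed.
HB.instance Definition _ :=
  GRing.isLinear.Build K D V *:%R orbit_fun orbit_fun_linear.
Definition orbit_map : 'Hom(D, V) := linfun orbit_fun.

Lemma orbit_mapE x : orbit_map x = act x v.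
Proof. exact: lfunE. Qed.

Lemma act_orbit_map x y : act x (orbit_map y) = orbit_map (x * y).
Proof. by rewrite !orbit_mapE actM comp_lfunE. Qed.

(** If [x v = 0] with [x] nonzero, then [x] is invertible and [v = x^-1 (x v) = 0], a
    contradiction. *)
Lemma lker0_orbit_map : lker orbit_map == 0%VS.
Proof.
rewrite -subv0; apply/subvP=> x; rewrite memv_ker memv0 => /eqP xv0.
apply: contraNT v_neq0 => /divD ux.
by rewrite -[v](id_lfunE) -act1 -orbit_mapE -(mulVr ux) -act_orbit_map xv0 linear0.
Qed.

Lemma limg_orbit_map : limg orbit_map = {:V}%VS.
Proof.
apply/eqP; rewrite eqEdim subvf dimV limg_dim_eq ?leqnn //.
by rewrite (eqP lker0_orbit_map) capv0.
Qed.

Lemma orbit_mapK : cancel orbit_map (orbit_map^-1)%VF.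
Proof. by move=> x; rewrite lker0_lfunK // lker0_orbit_map. Qed.

Lemma orbit_mapVK : cancel (orbit_map^-1)%VF orbit_map.
Proof. by move=> u; rewrite limg_lfunVK // limg_orbit_map memvf. Qed.

Lemma eq_on_orbit (f g : 'End(V)) :
  (forall x, f (orbit_map x) = g (orbit_map x)) -> f = g.
Proof. by move=> fg; apply/lfunP=> u; rewrite -[u]orbit_mapVK. Qed.

(** Right multiplication on [D] transported along the orbit map, [x v |-> x d v]. It depends on the
    choice of [v]. *)
Definition right_mul (d : D) : 'End(V) :=
  (orbit_map \o amulr d \o orbit_map^-1)%VF.

Lemma right_mulE d x : right_mul d (orbit_map x) = orbit_map (x * d).
Proof. by rewrite !comp_lfunE orbit_mapK [amulr d x]lfunE. Qed.

Lemma right_mul_comm d x : (right_mul d \o act x)%VF = (act x \o right_mul d)%VF.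
Proof.
apply: eq_on_orbit => y.
by rewrite [LHS]comp_lfunE [RHS]comp_lfunE act_orbit_map !right_mulE
  act_orbit_map mulrA.
Qed.

(** A [D]-linear map is determined by its value at [v]: if [g v = d v], then
    [g (x v) = x (g v) = x d v]. *)
Lemma comm_right_mul (g : 'End(V)) :
    (forall x, (g \o act x)%VF = (act x \o g)%VF) ->
  g = right_mul ((orbit_map^-1)%VF (g v)).
Proof.
move=> gact; apply: eq_on_orbit => x.
by rewrite right_mulE -act_orbit_map orbit_mapVK orbit_mapE -!comp_lfunE gact.
Qed.

End RankOneModule.

Lemma rep_end_rank_one (K : fieldType) (D : falgType K) (M : rep K)
    (act : {linear D -> 'End(rep_space M)}) (d1 d2 : D) (v : rep_space M) :
    act 1 = \1%VF -> (forall x y, act (x * y) = (act x \o act y)%VF) ->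
    (forall x : D, x != 0 -> x \is a GRing.unit) ->
    v != 0 -> \dim {:rep_space M} = \dim {:D} ->
    rep_e1 M = act d1 -> rep_e2 M = act d2 ->
    <<1 & [:: d1; d2]>>%VS = {:D}%VS ->
  exists f : {lrmorphism D^c -> rep_end M}, bijective f.
Proof.
move=> act1 actM divD v0 dimV e1 e2 gen.
have rP d : is_rep_end (right_mul act v d).
  by rewrite /is_rep_end e1 e2 !(right_mul_comm act1 actM divD v0 dimV) !eqxx.
pose f (d : D^c) : rep_end M := RepEnd (rP d).
have rE := right_mulE act1 actM divD v0.
have eqo := eq_on_orbit act1 actM divD v0 dimV.
have fl : linear f.
  move=> k x y; apply: val_inj; apply: eqo => z /=.
  by rewrite add_lfunE scale_lfunE !rE mulrDr -scalerAr linearP.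
have fm : monoid_morphism f.
  split=> [|x y]; apply: val_inj; apply: eqo => z /=.
    by rewrite rE mulr1 id_lfunE.
  (* Composition reverses products: applying [y] and then [x] sends [z v] to [z y x v], and [y x] is
     the product of [x] and [y] in [D^c]. *)
  by rewrite comp_lfunE !rE mulrA.
pose F : {lrmorphism D^c -> rep_end M} :=
  HB.pack f (GRing.isLinear.Build K D^c (rep_end M) *:%R f fl)
    (GRing.isMonoidMorphism.Build D^c (rep_end M) f fm).
(* The inverse sends [g] to the unique [d] with [g v = d v]. *)
exists F; exists (fun g : rep_end M => (orbit_map act v)^-1%VF (rep_end_val g v) : D^c) => [d | g].
  have /= := rE d 1; rewrite mul1r orbit_mapE act1 id_lfunE => ->.
  exact: (orbit_mapK act1 actM divD v0).
apply: val_inj; rewrite /= -(comm_right_mul act1 actM divD v0 dimV) //.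
(* An endomorphism of the representation commutes a priori only with [d1] and [d2]; generation
   extends this to all of [D]. *)
apply: (commuting_generated act1 actM gen) => x; rewrite !inE.
case/andP: (rep_endP g); rewrite e1 e2 => /eqP g1 /eqP g2.
by case/orP=> /eqP->.
Qed.

Section RestrictedAction.
Variables (K : fieldType) (L : fieldExtType K) (D : falgType K) (n : nat).
Variable Phi : {lrmorphism tensor L D -> 'M[L]_n}.

Definition res_act (x : D) : 'End(res_space 'cV[L]_n) :=
  res_end (linfun (mulmx (Phi (tens 1 x)))).

Lemma res_actE x u : res_act x u = Phi (tens 1 x) *m (u : 'cV[L]_n).
Proof. by rewrite /res_act res_endE lfunE. Qed.

Fact res_act_linear : linear res_act.
Proof.
move=> k x y; apply/lfunP=> u.
rewrite add_lfunE scale_lfunE !res_actE res_scaleE.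
(* The scalar [k] moves across the tensor sign into [L], where the [L]-linearity of [Phi]
   applies. *)
rewrite tensDr tensZr -[k *: 1]mulr1 tensZl linearP /=.
by rewrite mulmxDl -scalemxAl mulr1.
Qed.
HB.instance Definition _ :=
  GRing.isLinear.Build K D 'End(res_space 'cV[L]_n) *:%R res_act res_act_linear.

Lemma res_act1 : res_act 1 = \1%VF.
Proof.
by apply/lfunP=> u; rewrite res_actE id_lfunE tens1 rmorph1 mul1mx.
Qed.

Lemma res_actM x y : res_act (x * y) = (res_act x \o res_act y)%VF.
Proof.
apply/lfunP=> u; rewrite comp_lfunE !res_actE mulmxA.
by rewrite -[1 in LHS](mulr1 1) -tensM rmorphM.
Qed.

End RestrictedAction.

Lemma dim_res_space (K : fieldType) (L : fieldExtType K) (V : vectType L) :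
  \dim {:res_space V} = (\dim {:V} * \dim {:L})%N.
Proof. by rewrite !dimvf. Qed.

Theorem theorem4p3
  (K : fieldType) (n : nat) (D : falgType K) (L : splittingFieldType K)
  (rho : gal_of {:L} -> 'M[L]_n -> 'M[L]_n)
  (Phi : {lrmorphism tensor L D -> 'M[L]_n}) (d1 d2 : D)
  (charK : [pchar K] =i pred0)
  (divD : forall x : D, x != 0 -> x \is a GRing.unit)
  (centralD : ('Z({:D}))%VS = 1%VS)
  (degD : \dim {:D} = (n ^ 2)%N)
  (galL : galois 1 {:L})
  (degL : \dim {:L} = n)
  (Phi_bij : bijective Phi)
  (rho_action : gal_alg_action rho)
  (Phi_equivariant : {in 'Gal({:L} / 1)%g, forall s x,
     Phi (tensor_gal s x) = rho s (Phi x)})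
  (genD : <<1 & [:: d1; d2]>>%VS = {:D}%VS) :
  exists f : {lrmorphism D^c ->
      rep_end (res_rep (mx_rep (Phi (tens 1 d1)) (Phi (tens 1 d2))))},
    bijective f.
Proof.
have n_gt0 : (0 < n)%N by rewrite -degL adim_gt0.
(* Any nonzero vector would serve; the all-ones column is nonzero because [n > 0]. *)
pose v : 'cV[L]_n := const_mx 1.
have v_neq0 : v != 0.
  apply/eqP=> /colP /(_ (Ordinal n_gt0)); rewrite !mxE => /eqP.
  by rewrite oner_eq0.
pose M := res_rep (mx_rep (Phi (tens 1 d1)) (Phi (tens 1 d2))).
(* The loops of [M] are [res_act Phi d1] and [res_act Phi d2] by definition, so those conditions
   hold by conversion. *)
apply: (@rep_end_rank_one K D M (res_act Phi) d1 d2 v) => //.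
- exact: res_act1.
- exact: res_actM.
- by rewrite dim_res_space dimvf /dim /= muln1 degL degD.
Qed.
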